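(* Let $r,p,s$ be positive integers such that $s$ and $p$ divide $r$, and let $d=sp/\gcd(sp,r)$ (so that $G(r,p,s,n)$ is defined exactly when $d\mid n$). Then the following identity of formal power series in $u,q_1,q_2$ holds up to terms of degree $0$ in $u$ (that is, the coefficients of $u^n$ on both sides agree for every $n\ge 1$): $$\sum_{n\ge 1,\ d\mid n}u^n\,\mathrm{Hilb}\big(S_s[X,Y]^{\Delta G(r,p,s,n)}\big)(q_1,q_2)=\Bigg\{\sum_{l=0}^{p-1}\ \prod_{\substack{i,j\ge 0\\ i+j\equiv l\frac{r}{p}\ \mathrm{mod}\ r}}\frac{1}{1-u\,q_1^{i}q_2^{j}}\Bigg\}_{u^dq_1^s}.$$
   Context: Notation. For a power series $F$, $\{F\}_{u^dq_1^s}$ is obtained from $F$ by discarding all terms whose degree in $u$ is not divisible by $d$ or whose degree in $q_1$ is not divisible by $s$. Groups. $G(r,n)$ is the group of $n\times n$ complex matrices with exactly one nonzero entry in each row and column, the nonzero entries being $r$-th roots of unity. For $p\mid r$, $G(r,p,n)$ is the subgroup of the matrices $A\in G(r,n)$ such that $\det A/\det|A|$ is an $\frac{r}{p}$-th root of unity, where $|A|$ is the matrix of absolute values of the entries of $A$. For $s\mid r$ with $ps\mid rn$, $G(r,p,n)$ contains the cyclic group $C_s$ of scalar matrices generated by $e^{2\pi i/s}I$, and $G(r,p,s,n)=G(r,p,n)/C_s$. Invariants. $S_s[X,Y]$ is the subalgebra of $\mathbb C[x_1,\ldots,x_n,y_1,\ldots,y_n]$ generated by $1$ and the monomials whose degree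 in the $x$-variables and whose degree in the $y$-variables are both divisible by $s$. The group $G(r,p,n)$ acts on $\mathbb C[x_1,\ldots,x_n,y_1,\ldots,y_n]$ diagonally, i.e. by the same linear substitution on $x_1,\ldots,x_n$ and on $y_1,\ldots,y_n$; since $C_s$ acts trivially on $S_s[X,Y]$, this induces an action of $G(r,p,s,n)$ on $S_s[X,Y]$ (the action of the diagonal subgroup $\Delta G(r,p,s,n)\subset G(r,p,s,n)\times G(r,p,s,n)$), whose invariant algebra is $S_s[X,Y]^{\Delta G(r,p,s,n)}$. $\mathrm{Hilb}(A)(q_1,q_2)=\sum_{a,b\ge 0}\dim(A_{a,b})\,q_1^aq_2^b$, where $A_{a,b}$ is the subspace of elements of degree $a$ in the $x$-variables and $b$ in the $y$-variables. *)

(* Defs.v *)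
From HB Require Import structures.
From mathcomp Require Import all_boot all_order all_algebra.
From mathcomp Require Import complex boolp classical_sets reals trigo.
From mathcomp Require Import mpoly.

Set Implicit Arguments.
Unset Strict Implicit.
Unset Printing Implicit Defensive.

Import Order.TTheory GRing.Theory Num.Theory.
Local Open Scope ring_scope.

Record fps (R : comNzRingType) := FPS { fps_coef :> nat -> R }.

Section FpsRing.
Variable R : comNzRingType.
Implicit Types F G H : fps R.

Lemma fpsP F G : (forall n, F n = G n) -> F = G.
Proof. by case: F G => [f] [g] /= fg; congr FPS; apply: funext. Qed.

HB.instance Definition _ := gen_eqMixin (fps R).
HB.instance Definition _ := gen_choiceMixin (fps R).

Definition fps_zero : fps R := FPS (fun=> 0).
Definition fps_opp F := FPS (fun n => - F n).
Definition fps_add F G := FPS (fun n => F n + G n).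
Definition fps_mul F G := FPS (fun n => \sum_(i < n.+1) F i * G (n - i)%N).
Definition fps_const (c : R) : fps R := FPS (fun n => if n == 0%N then c else 0).
Definition fps_X : fps R := FPS (fun n => (n == 1%N)%:R).

Fact fps_addA : associative fps_add.
Proof. by move=> F G H; apply: fpsP => n /=; rewrite addrA. Qed.
Fact fps_addC : commutative fps_add.
Proof. by move=> F G; apply: fpsP => n /=; rewrite addrC. Qed.
Fact fps_add0 : left_id fps_zero fps_add.
Proof. by move=> F; apply: fpsP => n /=; rewrite add0r. Qed.
Fact fps_addN : left_inverse fps_zero fps_opp fps_add.
Proof. by move=> F; apply: fpsP => n /=; rewrite addNr. Qed.

HB.instance Definition _ :=
  GRing.isZmodule.Build (fps R) fps_addA fps_addC fps_add0 fps_addN.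

Definition fps_trunc (N : nat) F : {poly R} := \poly_(i < N) F i.

Fact fps_mul_trunc N F G n : (n < N)%N ->
  fps_mul F G n = (fps_trunc N F * fps_trunc N G)`_n.
Proof.
move=> nN; rewrite coefM /=; apply: eq_bigr => i _.
by rewrite !coef_poly (leq_ltn_trans (leq_ord i) nN)
  (leq_ltn_trans (leq_subr _ _) nN).
Qed.

Fact fps_mulA : associative fps_mul.
Proof.
move=> F G H; apply: fpsP => n.
pose t := fps_trunc n.+1.
transitivity ((t F * (t G * t H))`_n).
  rewrite coefM [LHS]/=; apply: eq_bigr => i _; congr (_ * _).
    by rewrite coef_poly ltn_ord.
  by rewrite -(@fps_mul_trunc n.+1) // ltnS leq_subr.
rewrite mulrA coefM; apply: eq_bigr => i _; congr (_ * _).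
  by rewrite -(@fps_mul_trunc n.+1).
by rewrite coef_poly ltnS leq_subr.
Qed.

Fact fps_mulC : commutative fps_mul.
Proof.
by move=> F G; apply: fpsP => n; rewrite !(@fps_mul_trunc n.+1) // mulrC.
Qed.

Fact fps_mul1 : left_id (fps_const 1) fps_mul.
Proof.
move=> F; apply: fpsP => n /=; rewrite big_ord_recl /= mul1r subn0.
by rewrite big1 ?addr0 // => i _; rewrite mul0r.
Qed.

Fact fps_mulD : left_distributive fps_mul fps_add.
Proof.
move=> F G H; apply: fpsP => n /=; rewrite -big_split /=.
by apply: eq_bigr => i _; rewrite mulrDl.
Qed.

Fact fps_1neq0 : fps_const 1 != 0.
Proof.
by apply/eqP => /(congr1 (fun F : fps R => F 0%N)) /= /eqP; rewrite oner_eq0.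
Qed.

HB.instance Definition _ := GRing.Zmodule_isComNzRing.Build (fps R)
  fps_mulA fps_mulC fps_mul1 fps_mulD fps_1neq0.

Definition fps_unit : pred (fps R) := fun F => `[< exists G, G * F = 1 >].
(* By convention the inverse of a non-invertible series is itself. *)
Definition fps_inv F : fps R := xget F [set G | G * F = 1].

Fact fps_mulV : {in fps_unit, left_inverse 1 fps_inv *%R}.
Proof.
move=> F /asboolP [G GF].
by rewrite /fps_inv; case: xgetP => [H _ //|/(_ G)]; case.
Qed.
Fact fps_intro_unit F G : G * F = 1 -> fps_unit F.
Proof. by move=> GF; apply/asboolP; exists G. Qed.
Fact fps_inv_out : {in [predC fps_unit], fps_inv =1 id}.
Proof.
move=> F /asboolPn nF; rewrite /fps_inv; case: xgetP => // H _ HF.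
by case: nF; exists H.
Qed.

HB.instance Definition _ := GRing.ComNzRing_hasMulInverse.Build (fps R)
  fps_mulV fps_intro_unit fps_inv_out.

End FpsRing.

(* Z[[q1, q2]] and Z[[u, q1, q2]]: [F n a b] is the coefficient of
   u^n q1^a q2^b in F. *)
Notation fps2 := (fps (fps int)).
Notation fps3 := (fps (fps (fps int))).

Definition ser_u : fps3 := fps_X _.
Definition ser_q1 : fps3 := fps_const (fps_X _).
Definition ser_q2 : fps3 := fps_const (fps_const (fps_X _)).

(* Unconditional coefficientwise convergence of the product of a family. *)
Definition is_fps_prod (I : eqType) (P : pred I) (F : I -> fps3) (L : fps3) :=
  forall n a b : nat, exists t0 : seq I, forall t : seq I,
    uniq t -> {subset t0 <= t} -> (\prod_(i <- t | P i) F i) n a b = L n a b.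

(* The value of the infinite product (0 if it does not converge). *)
Definition fps_prod (I : eqType) (P : pred I) (F : I -> fps3) : fps3 :=
  xget 0 [set L | is_fps_prod P F L].

(* {F}_{u^d q1^s} *)
Definition keep_multiples (d s : nat) (F : fps3) : fps3 :=
  FPS (fun n => FPS (fun a => FPS (fun b =>
    if (d %| n)%N && (s %| a)%N then F n a b else 0))).

Definition has_dim (K : fieldType) (V : lmodType K) (A : set V) (k : nat) :=
  exists v : 'I_k -> V,
    [/\ forall i, A (v i),
        forall c : 'I_k -> K, \sum_i c i *: v i = 0 -> forall i, c i = 0
      & forall x, A x -> exists c : 'I_k -> K, x = \sum_i c i *: v i].

(* Only used for finite-dimensional subspaces; the value is 0 otherwise. *)
Definition dim_of (K : fieldType) (V : lmodType K) (A : set V) : nat :=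
  xget 0%N [set k | has_dim A k].

Inductive subalg_gen (K : comNzRingType) (A : lalgType K) (G : set A) : A -> Prop :=
| Subalg_gen f : G f -> subalg_gen G f
| Subalg_one : subalg_gen G 1
| Subalg_add f g : subalg_gen G f -> subalg_gen G g -> subalg_gen G (f + g)
| Subalg_mul f g : subalg_gen G f -> subalg_gen G g -> subalg_gen G (f * g)
| Subalg_scale c f : subalg_gen G f -> subalg_gen G (c *: f).

Section Groups.
Variables (R : realType) (n : nat).
Implicit Types (r p s : nat) (A B : 'M[R[i]]_n).

Definition Grn r : set 'M[R[i]]_n := [set A |
  [/\ forall i, exists! j, A i j != 0,
      forall j, exists! i, A i j != 0
    & forall i j, A i j != 0 -> A i j ^+ r = 1]].

Definition Grpn r p : set 'M[R[i]]_n := [set A |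
  Grn r A /\ (\det A / \det (map_mx Num.norm A)) ^+ (r %/ p) = 1].

(* e^(2 pi i / s), in Cartesian form *)
Definition zeta s : R[i] :=
  (cos (2 * pi / s%:R) +i* sin (2 * pi / s%:R))%C.

Definition Cs s : set 'M[R[i]]_n := [set A | exists k, A = (zeta s ^+ k)%:M].

Definition coset_Cs s A : set 'M[R[i]]_n :=
  [set B | exists2 Z, Cs s Z & B = Z *m A].

(* G(r,p,n) / C_s as its set of cosets; C_s is central, so left and right
   cosets agree. *)
Definition Grpsn r p s : set (set 'M[R[i]]_n) :=
  [set K | exists2 A, Grpn r p A & K = coset_Cs s A].

(* C[x_1..x_n, y_1..y_n]: the x-variables are the indices [lshift n i], the
   y-variables the indices [rshift n i]. *)
Definition xdeg (m : 'X_{1..n + n}) : nat := \sum_(i < n) m (lshift n i).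
Definition ydeg (m : 'X_{1..n + n}) : nat := \sum_(i < n) m (rshift n i).

Definition S_XY s : set {mpoly R[i][n + n]} :=
  subalg_gen [set f | exists m : 'X_{1..n + n},
    [/\ (s %| xdeg m)%N, (s %| ydeg m)%N & f = 'X_[m]]].

(* The diagonal substitution x_j |-> sum_i A_ij x_i, y_j |-> sum_i A_ij y_i,
   which makes A |-> diag_act A a left action. *)
Definition diag_subst A (k : 'I_(n + n)) : {mpoly R[i][n + n]} :=
  match split k with
  | inl j => \sum_(i < n) A i j *: 'X_(lshift n i)
  | inr j => \sum_(i < n) A i j *: 'X_(rshift n i)
  end.

Definition diag_act A (f : {mpoly R[i][n + n]}) : {mpoly R[i][n + n]} :=
  f \mPo [tuple diag_subst A k | k < n + n].

(* The induced action of a coset on S_XY s, through some representative; it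
   does not depend on the representative, see [coset_actE]. *)
Definition coset_act (K : set 'M[R[i]]_n) (f : {mpoly R[i][n + n]}) :=
  diag_act (xget 1%:M K) f.

Definition S_XY_inv r p s : set {mpoly R[i][n + n]} :=
  [set f | S_XY s f /\ forall K, Grpsn r p s K -> coset_act K f = f].

Definition bihom (A : set {mpoly R[i][n + n]}) (a b : nat) :
    set {mpoly R[i][n + n]} :=
  [set f | A f /\ forall m, m \in msupp f -> xdeg m = a /\ ydeg m = b].

Definition Hilb (A : set {mpoly R[i][n + n]}) : fps2 :=
  FPS (fun a => FPS (fun b => (dim_of (bihom A a b))%:Z)).

Lemma zeta_expE s k :
  zeta s ^+ k = (cos (k%:R * (2 * pi / s%:R)) +i* sin (k%:R * (2 * pi / s%:R)))%C.
Proof.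
elim: k => [|k IHk]; first by rewrite expr0 mul0r cos0 sin0.
rewrite exprSr IHk /zeta; set t := 2 * pi / s%:R.
have -> : k.+1%:R * t = k%:R * t + t by rewrite -[k.+1]addn1 natrD mulrDl mul1r.
by rewrite cosD sinD; apply/eqP; rewrite eq_complex /= eqxx [X in _ == X]addrC eqxx.
Qed.

Lemma zeta_exp1 s : (0 < s)%N -> zeta s ^+ s = 1.
Proof.
move=> s0; rewrite zeta_expE mulrC divfK ?pnatr_eq0 -?lt0n //.
by rewrite mulr_natl cos2pi sin2pi.
Qed.

Lemma coset_CsP s A B :
  coset_Cs s A B -> (0 < s)%N -> exists2 c, c ^+ s = 1 & B = c *: A.
Proof.
case=> Z [k ->] -> s0; exists (zeta s ^+ k); last by rewrite mul_scalar_mx.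
by rewrite exprAC zeta_exp1 ?expr1n.
Qed.

Lemma mdeg_xy (m : 'X_{1..n + n}) : mdeg m = (xdeg m + ydeg m)%N.
Proof. by rewrite mdegE big_split_ord. Qed.

Lemma diag_act_scale s c A f : c ^+ s = 1 -> S_XY s f ->
  diag_act (c *: A) f = diag_act A f.
Proof.
move=> cs; rewrite /diag_act.
elim=> {f} [f [m [sx sy ->]]||f g _ IHf _ IHg|f g _ IHf _ IHg|a f _ IHf].
- rewrite !comp_mpolyX.
  under eq_bigr => k _.
    rewrite tnth_mktuple.
    have -> : diag_subst (c *: A) k = c *: diag_subst A k.
      rewrite /diag_subst; case: (split k) => j; rewrite scaler_sumr;
        by apply: eq_bigr => i _; rewrite scalerA mxE.
    rewrite exprZn; over.
  rewrite scaler_prod prodrXr -mdegE.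
  have /dvdnP [q ->] : (s %| mdeg m)%N by rewrite mdeg_xy dvdn_add.
  rewrite mulnC exprM cs expr1n scale1r.
  by apply: eq_bigr => k _; rewrite tnth_mktuple.
- by rewrite !comp_mpoly1.
- by rewrite !comp_mpolyD IHf IHg.
- by rewrite !rmorphM /= IHf IHg.
- by rewrite !comp_mpolyZ IHf.
Qed.

Lemma coset_actE r p s K A f : (0 < s)%N ->
  Grpsn r p s K -> K A -> S_XY s f -> coset_act K f = diag_act A f.
Proof.
move=> s0 [B _ ->] BA Sf; rewrite /coset_act.
set A' := xget _ _.
have BA' : coset_Cs s B A' by apply: xgetPex; exists A.
have [c c1 ->] := coset_CsP BA s0; have [c' c'1 ->] := coset_CsP BA' s0.
by rewrite (diag_act_scale B c1 Sf) (diag_act_scale B c'1 Sf).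
Qed.

End Groups.

(* Main.v *)
(* Both sides count multisets. Expanding the geometric series, the coefficient
   of u^n q1^a q2^b in the l-th product is the number of multisets of n pairs
   (i, j) with i + j = l r/p mod r whose coordinates sum to a and b. On the other
   side, an invariant polynomial is supported on monomials fixed by the diagonal
   matrices of G(r,p,n), and a monomial is fixed iff the n numbers
   deg_{x_k} + deg_{y_k} are all congruent to l r/p mod r for one l < p; the
   permutation matrices then leave the orbit sums of such monomials as a basis,
   one for each multiset of pairs (deg_{x_k}, deg_{y_k}). Finally
   a + b = n l r/p mod r, and d | n forces s | n r/p, so for d | n the conditions
   s | a and s | b are equivalent, which is why only q1 is filtered. *)
Require Import Defs.
From mathcomp Require Import all_boot all_order fingroup perm all_algebra.
From mathcomp Require Import complex boolp classical_sets reals trigo.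
From mathcomp Require Import mpoly.

Set Implicit Arguments.
Unset Strict Implicit.
Unset Printing Implicit Defensive.

Import Order.TTheory GRing.Theory Num.Theory.
Local Open Scope ring_scope.

(** * Coefficients of power series *)

Section FpsCoef.
Variable R : comNzRingType.
Implicit Types (F G : fps R) (c : R).

Lemma fps_coefM F G n : (F * G) n = \sum_(i < n.+1) F i * G (n - i)%N.
Proof. by []. Qed.

Lemma fps_coefD F G n : (F + G) n = F n + G n.
Proof. by []. Qed.

Lemma fps_coef1 n : (1 : fps R) n = (n == 0%N)%:R.
Proof. by rewrite /= ; case: eqP. Qed.

Lemma fps_coef_sum I (r : seq I) (P : pred I) (F : I -> fps R) n :
  (\sum_(i <- r | P i) F i) n = \sum_(i <- r | P i) F i n.
Proof. by elim/big_rec2: _ => [//|i x y _ <-]. Qed.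

Lemma fps_coef_constM c F n : (fps_const c * F) n = c * F n.
Proof.
rewrite fps_coefM big_ord_recl /= subn0 big1 ?addr0 // => i _.
by rewrite mul0r.
Qed.

Lemma fps_coef_XM F n : (fps_X R * F) n = if n is k.+1 then F k else 0.
Proof.
rewrite fps_coefM; case: n => [|n].
  by rewrite big_ord_recl big_ord0 /= mul0r addr0.
rewrite !big_ord_recl /= mul0r add0r mul1r subSS subn0 big1 ?addr0 // => i _.
by rewrite mul0r.
Qed.

Lemma fps_coef_XnM i F n :
  (fps_X R ^+ i * F) n = if (i <= n)%N then F (n - i)%N else 0.
Proof.
elim: i n => [|i IH] n; first by rewrite mul1r subn0.
by rewrite exprS -mulrA fps_coef_XM; case: n => [|n] //; rewrite IH.
Qed.

Lemma fps_constM c c' : fps_const (c * c') = fps_const c * fps_const c'.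
Proof. by apply: fpsP => n; rewrite fps_coef_constM /=; case: eqP; rewrite ?mulr0. Qed.

Lemma fps_constX c i : fps_const (c ^+ i) = fps_const c ^+ i.
Proof. by elim: i => [//|i IH]; rewrite !exprS fps_constM IH. Qed.

(** The series with coefficients [c ^+ n] is an explicit inverse, so the inverse, which is defined
    by choice, is genuine. The fixed-point form is what yields a recursion on coefficients. *)
Lemma fps_geometricE c :
  (1 - fps_X R * fps_const c)^-1 = 1 + fps_X R * fps_const c * (1 - fps_X R * fps_const c)^-1.
Proof.
pose G := FPS (fun n => c ^+ n) : fps R.
have GE : G = 1 + fps_X R * fps_const c * G.
  apply: fpsP => -[|n]; rewrite fps_coefD -mulrA fps_coef_XM ?addr0 //.
  by rewrite fps_coef_constM fps_coef1 add0r -exprS.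
have U : (1 - fps_X R * fps_const c) \is a GRing.unit.
  apply/unitrPr; exists G.
  by rewrite mulrBl mul1r {1}GE addrK.
apply: (mulrI U); rewrite mulrDr mulrCA !divrr // !mulr1.
by rewrite subrK.
Qed.

End FpsCoef.

(** * Products of geometric series, expanded by multisets *)

Definition geom (ij : nat * nat) : fps3 :=
  1 / (1 - ser_u * ser_q1 ^+ ij.1 * ser_q2 ^+ ij.2).

(** Since [geom ij] is 1 plus u q1^i q2^j times itself, a term either takes the constant term of the
    factor or gives up one copy of [ij]. The recursion of [msets] has the same two branches. *)
Lemma coef_geomM ij (Q : fps3) n a b : (geom ij * Q) n a b = Q n a b +
  (if n is k.+1 then if (ij.1 <= a)%N && (ij.2 <= b)%N
     then (geom ij * Q) k (a - ij.1)%N (b - ij.2)%N else 0 else 0).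
Proof.
rewrite {1}/geom -mulrA /ser_q1 /ser_q2 -!fps_constX -fps_constM fps_geometricE.
rewrite fps_constM !fps_constX -/ser_q1 -/ser_q2 mulrA -[_^-1]mul1r -/(geom ij).
rewrite mul1r mulrDl mul1r !fps_coefD; congr (_ + _).
rewrite -!mulrA fps_coef_XM; case: n => // n.
rewrite /ser_q1 /ser_q2 -!fps_constX !fps_coef_constM fps_coef_XnM.
case: (ij.1 <= a)%N; rewrite ?andTb ?andFb; last by [].
set M := _ * Q.
by rewrite fps_coef_constM fps_coef_XnM !mul1r.
Qed.

(* Lists each multiset of n elements of t exactly once, as a sequence following
   the order of t, provided t is duplicate-free. *)
Fixpoint msets (T : Type) (t : seq T) : nat -> seq (seq T) :=
  if t is x :: t' then
    fix msets_x n := if n is k.+1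
      then map (cons x) (msets_x k) ++ msets t' n else [:: [::]]
  else fun n => if n is 0 then [:: [::]] else [::].

Lemma msetsS (T : Type) x (t : seq T) n :
  msets (x :: t) n.+1 = map (cons x) (msets (x :: t) n) ++ msets t n.+1.
Proof. by []. Qed.

Lemma msets0 (T : Type) (t : seq T) : msets t 0 = [:: [::]].
Proof. by case: t. Qed.

Section Msets.
Variable T : eqType.
Implicit Types (t w : seq T).

Lemma msets_sub t n w : w \in msets t n -> size w = n /\ {subset w <= t}.
Proof.
elim: t n w => [|x t IHt] n.
  by case: n => // w; rewrite mem_seq1 => /eqP->.
elim: n => [|n IHn] w; first by rewrite msets0 mem_seq1 => /eqP->.
rewrite msetsS mem_cat => /orP[/mapP[v /IHn[sv vt] ->]|/IHt[sw wt]].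
  by split; [rewrite /= sv|move=> y; rewrite in_cons => /predU1P[->|/vt//]; rewrite mem_head].
by split=> // y /wt; rewrite in_cons => ->; rewrite orbT.
Qed.

(** For a list [x :: t]: if [x] occurs in [w], only the sequences starting with [x] can match, and
    removing one copy gives a shorter word; otherwise only those drawn from [t] can match. Hence an
    induction on the list with an inner one on the size of [w]. *)
Lemma count_msets t w : uniq t -> {subset w <= t} ->
  count (perm_eq w) (msets t (size w)) = 1%N.
Proof.
elim: t w => [|x t IHt] w.
  by case: w => [//|y w _ /(_ y (mem_head _ _))].
case/andP => xt ut; have [k] := ubnP (size w); elim: k w => // k IHk [|y w] //.
rewrite ltnS; set w' := y :: w => sw wt; rewrite -[size w']/(size w).+1 msetsS count_cat count_map.
have [xw|xw] := boolP (x \in w').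
  have w'E := perm_to_rem xw.
  rewrite (@eq_count _ _ (perm_eq (rem x w'))); last first.
    by move=> v /=; rewrite (permPl w'E) perm_cons.
  have sr : size (rem x w') = size w by rewrite size_rem.
  rewrite -sr IHk ?sr //; last by move=> z /mem_rem /wt.
  rewrite (@eq_in_count _ _ pred0) ?count_pred0 // => v /msets_sub[_ vt] /=.
  apply/negP => /perm_mem /(_ x); rewrite xw => /esym /vt.
  by rewrite (negPf xt).
rewrite (@eq_in_count _ _ pred0) ?count_pred0 ?add0n.
  rewrite -[(size w).+1]/(size w') IHt // => z zw; move: (wt z zw).
  by rewrite in_cons => /predU1P[zx|//]; rewrite -zx zw in xw.
move=> v _ /=; apply/negP => /perm_mem /(_ x).
by rewrite mem_head (negPf xw).
Qed.

End Msets.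

Definition sum1 (w : seq (nat * nat)) := sumn (map fst w).
Definition sum2 (w : seq (nat * nat)) := sumn (map snd w).

Lemma geomM_prod x t :
  geom x * \prod_(ij <- t) geom ij = \prod_(ij <- x :: t) geom ij.
Proof. by rewrite big_cons. Qed.

Lemma coef_prod_geom t n a b : (\prod_(ij <- t) geom ij) n a b =
  (count (fun w => (sum1 w == a) && (sum2 w == b)) (msets t n))%:R.
Proof.
elim: t n a b => [|x t IHt] n a b.
  rewrite big_nil; case: n => [|n] //.
  rewrite /= addn0; case: a => [|a] //; by case: b.
elim: n a b => [|n IHn] a b; rewrite big_cons coef_geomM IHt.
  by rewrite !msets0 addr0.
rewrite msetsS count_cat natrD addrC; congr (_ + _).
rewrite geomM_prod IHn count_map; case: ifP => [/andP[xa xb]|xab].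
  congr (_ %:R); apply: eq_count => w /=.
  by rewrite /sum1 /sum2 /= -(eqn_add2l x.1) -(eqn_add2l x.2 (sumn _)) !subnKC.
rewrite (@eq_count _ _ pred0) ?count_pred0 // => w /=.
apply/negP => /andP[/eqP wa /eqP wb]; move: xab.
by rewrite -wa -wb /sum1 /sum2 /= !leq_addr.
Qed.

Definition box a b : seq (nat * nat) :=
  [seq (i, j) | i <- iota 0 a.+1, j <- iota 0 b.+1].

Lemma mem_box a b ij : (ij \in box a b) = (ij.1 <= a)%N && (ij.2 <= b)%N.
Proof.
apply/allpairsP/andP => [[x [+ + ->]]|[ia jb]].
  by rewrite !mem_iota.
by exists ij; rewrite !mem_iota; split=> //; case: ij {ia jb}.
Qed.

(** A factor outside the box has i > a or j > b, so it acts as 1 on coefficients of degree at most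
    (a, b). The bounds [a'], [b'] vary because the recursion lowers the degrees. *)
Lemma coef_prod_geom_box t n a b a' b' : (a' <= a)%N -> (b' <= b)%N ->
  (\prod_(ij <- t) geom ij) n a' b' =
  (\prod_(ij <- [seq ij <- t | ij \in box a b]) geom ij) n a' b'.
Proof.
elim: t n a' b' => [//|x t IHt] n a' b' aa bb /=.
case: ifP => [xin|xout].
  elim: n a' b' aa bb => [|n IHn] a' b' aa bb.
    rewrite -!geomM_prod [LHS]coef_geomM [RHS]coef_geomM.
    exact: (congr2 +%R (IHt 0%N _ _ aa bb)).
  rewrite -!geomM_prod [LHS]coef_geomM [RHS]coef_geomM.
  apply: (congr2 +%R (IHt n.+1 _ _ aa bb)).
  rewrite !geomM_prod; case: ifP => // _.
  by rewrite IHn ?(leq_trans (leq_subr _ _)).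
rewrite big_cons coef_geomM -IHt //; case: n => [|n]; first by rewrite addr0.
case: ifP => [/andP[xa xb]|_]; last by rewrite addr0.
by move: xout; rewrite mem_box (leq_trans xa aa) (leq_trans xb bb).
Qed.

Lemma box_uniq a b : uniq (box a b).
Proof. by apply: allpairs_uniq; rewrite ?iota_uniq // => -[x y] [u v]. Qed.

Lemma is_fps_prod_uniq (I : eqType) (P : pred I) (F : I -> fps3) L L' :
  is_fps_prod P F L -> is_fps_prod P F L' -> L = L'.
Proof.
move=> HL HL'; apply: fpsP => n; apply: fpsP => a; apply: fpsP => b.
have [t0 H0] := HL n a b; have [t1 H1] := HL' n a b.
rewrite -(H0 (undup (t0 ++ t1))) ?undup_uniq //; last first.
  by move=> x xt; rewrite mem_undup mem_cat xt.
by apply: H1; rewrite ?undup_uniq // => x xt; rewrite mem_undup mem_cat xt orbT.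
Qed.

Lemma coef_fps_prod_geom (P : pred (nat * nat)) n a b :
  fps_prod P geom n a b = (count (fun w => (sum1 w == a) && (sum2 w == b))
      (msets [seq ij <- box a b | P ij] n))%:R.
Proof.
pose L : fps3 := FPS (fun n => FPS (fun a => FPS (fun b =>
  (\prod_(ij <- box a b | P ij) geom ij) n a b))).
have LP : is_fps_prod P geom L.
  (* A family containing the box only adds factors outside it, which leave this coefficient
     unchanged. *)
  move=> {}n {}a {}b; exists (box a b) => t ut bt.
  rewrite /L /= -big_filter (@coef_prod_geom_box _ _ a b) // -filter_predI.
  rewrite -[in RHS]big_filter; apply: (congr1 (fun F : fps3 => F n a b)).
  apply: perm_big; apply: uniq_perm; rewrite ?filter_uniq ?box_uniq // => x.
  rewrite !mem_filter /=; have [xb|_] := boolP (x \in box a b).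
    by rewrite bt // andbT.
  by rewrite andbF.
have prodP : is_fps_prod P geom (fps_prod P geom).
  exact: (@xgetI _ _ [set L | is_fps_prod P geom L]%classic _ LP).
by rewrite (is_fps_prod_uniq prodP LP) /L /= -big_filter coef_prod_geom.
Qed.

(** * Uniqueness of the dimension *)

Lemma has_dim_leq (K : fieldType) (V : lmodType K) (A : set V) k k' :
  has_dim A k -> has_dim A k' -> (k <= k')%N.
Proof.
case=> v [Av free_v _] [u [_ _ span_u]].
have [C vE] : exists C : 'M[K]_(k, k'), forall i, v i = \sum_j C i j *: u j.
  have /boolp.choice [C vE] : forall i, exists c : 'I_k' -> K, v i = \sum_j c j *: u j.
    by move=> i; apply: span_u.
  by exists (\matrix_(i, j) C i j) => i; rewrite vE; apply: eq_bigr => j _; rewrite mxE.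
(* A row vector killed by [C] gives a vanishing combination of the free family [v], so [C] has rank
   [k], which is at most its number [k'] of columns. *)
suff /eqP <- : row_free C by apply: rank_leq_col.
rewrite -kermx_eq0; apply/eqP/row_matrixP => l; rewrite row0.
have kC : row l (kermx C) *m C = 0 by rewrite -row_mul mulmx_ker row0.
apply/rowP => i; rewrite [RHS]mxE; apply: (free_v (fun i => row l (kermx C) 0 i)).
under eq_bigr => j _ do rewrite vE scaler_sumr.
rewrite exchange_big big1 //= => j _.
under eq_bigr => m _ do rewrite scalerA.
rewrite -scaler_suml; move/rowP/(_ j): kC; rewrite !mxE => kC.
by rewrite [X in X *: _](_ : _ = 0) ?scale0r.
Qed.

Lemma dim_ofE (K : fieldType) (V : lmodType K) (A : set V) k :
  has_dim A k -> dim_of A = k.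
Proof.
move=> Ak; rewrite /dim_of; case: xgetP => [k' _ Ak'|/(_ k) //].
by apply/eqP; rewrite eqn_leq !(has_dim_leq Ak', has_dim_leq Ak).
Qed.

(** * Roots of unity, supports of polynomials and monomial matrices *)

Section Invariants.
Variables (R : realType) (n : nat).
Local Notation C := R[i].
Implicit Types (m : 'X_{1..n + n}) (t : 'S_n) (c : 'I_n -> C) (f : {mpoly C[n + n]}).

(** Let q be the remainder of k modulo r. If q > 0, the half angle y = pi q / r lies strictly
    between 0 and pi, so sin y > 0, whereas cos(2y) = 1 forces sin y = 0. *)
Lemma zeta_exp_eq1 r k : (0 < r)%N -> zeta R r ^+ k = 1 -> (r %| k)%N.
Proof.
move=> r0; rewrite {1}(divn_eq k r) exprD mulnC exprM zeta_exp1 // expr1n mul1r.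
rewrite /dvdn; have [//|q0] := posnP (k %% r); have := ltn_pmod k r0.
set q := (k %% r)%N in q0 * => qr; rewrite zeta_expE => -[].
set y : R := pi * (q%:R / r%:R).
have -> : q%:R * (2 * pi / r%:R) = y + y.
  by rewrite /y -mulr2n -[RHS]mulr_natl -mulrA mulrCA; congr (_ * _); rewrite mulrCA.
have : 0 < sin y.
  apply: sin_gt0_pi; rewrite /y mulr_gt0 ?pi_gt0 ?divr_gt0 ?ltr0n //=.
  by rewrite -[ltRHS]mulr1 ltr_pM2l ?pi_gt0 // ltr_pdivrMr ?ltr0n // mul1r ltr_nat.
rewrite cosD -!expr2 cos2sin2 -addrA -opprD -mulr2n => sy.
move=> /(canRL (addKr _)); rewrite addNr => /eqP.
by rewrite oppr_eq0 mulrn_eq0 /= expf_eq0 /= gt_eqF.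
Qed.

Lemma xdegD m m' : xdeg (m + m')%MM = (xdeg m + xdeg m')%N.
Proof. by rewrite /xdeg -big_split; apply: eq_bigr => i _; rewrite mnmDE. Qed.

Lemma ydegD m m' : ydeg (m + m')%MM = (ydeg m + ydeg m')%N.
Proof. by rewrite /ydeg -big_split; apply: eq_bigr => i _; rewrite mnmDE. Qed.

Lemma S_XYP s f : S_XY s f <->
  (forall m, m \in msupp f -> (s %| xdeg m)%N /\ (s %| ydeg m)%N).
Proof.
split.
  elim=> {f} [f [m [sx sy ->]]||f g _ IHf _ IHg|f g _ IHf _ IHg|a f _ IHf] m'.
  - by rewrite msuppX mem_seq1 => /eqP->.
  - rewrite -mpolyC1 msupp1 mem_seq1 => /eqP->.
    by rewrite /xdeg /ydeg !big1 ?dvdn0 // => i _; rewrite mnm0E.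
  - by move=> /msuppD_le; rewrite mem_cat => /orP[/IHf|/IHg].
  - move=> /msuppM_le /allpairsP[[m1 m2] /= [/IHf[x1 y1] /IHg[x2 y2] ->]].
    by rewrite xdegD ydegD !dvdn_add.
  - by move=> /msuppZ_le /IHf.
move=> H; rewrite (mpolyE f); move: H.
elim: (msupp f) => [|m ms IH] H.
  (* The zero polynomial is reached as [0 *: 1]. *)
  by rewrite big_nil -(scale0r 1); apply: Subalg_scale; apply: Subalg_one.
rewrite big_cons; apply: Subalg_add.
  apply: Subalg_scale; apply: Subalg_gen; exists m.
  by have [] := H m (mem_head _ _).
by apply: IH => m' m'ms; apply: H; rewrite in_cons m'ms orbT.
Qed.

(** Scalars in [Cs s] act trivially on [S_XY s], so invariance can be tested on matrices and the
    quotient group disappears from the argument. *)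
Lemma S_XY_invP r p s f : (0 < s)%N -> S_XY_inv r p s f <->
  S_XY s f /\ forall A, Grpn r p A -> diag_act A f = f.
Proof.
move=> s0; have cA (A : 'M[C]_n) : coset_Cs s A A.
  by exists 1%:M; rewrite ?mul1mx //; exists 0%N.
split=> -[Sf inv_f]; split=> //.
  move=> A GA; have GK : Grpsn r p s (coset_Cs s A) by exists A.
  by rewrite -(coset_actE s0 GK (cA A) Sf) inv_f.
move=> _ [A GA ->]; have GK : Grpsn r p s (coset_Cs s A) by exists A.
by rewrite (coset_actE s0 GK (cA A) Sf) inv_f.
Qed.

Definition mono_mx t c : 'M[C]_n := \matrix_(i, j) (if i == t j then c j else 0).

Lemma det_mono_mx t c : \det (mono_mx t c) = (-1) ^+ t * \prod_j c j.
Proof.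
have -> : mono_mx t c = perm_mx t^-1%g *m diag_mx (\row_j c j).
  apply/matrixP => i j; rewrite mul_mx_diag !mxE.
  rewrite -(inj_eq (@perm_inj _ t) (t^-1%g i)) permKV.
  by case: eqP => _; rewrite ?mul1r ?mul0r.
rewrite det_mulmx det_perm odd_permV det_diag; congr (_ * _).
by apply: eq_bigr => j _; rewrite mxE.
Qed.

(** The matrix of absolute values is the bare permutation matrix, so the sign of [t] cancels. *)
Lemma det_ratio_mono_mx t c : (forall j, `|c j| = 1) ->
  \det (mono_mx t c) / \det (map_mx Num.norm (mono_mx t c)) = \prod_j c j.
Proof.
move=> c1; have -> : map_mx Num.norm (mono_mx t c) = mono_mx t (fun=> 1).
  by apply/matrixP => i j; rewrite !mxE; case: eqP; rewrite ?c1 ?normr0.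
rewrite !det_mono_mx big1_eq mulr1.
by case: (odd_perm t); rewrite ?expr1 ?expr0 ?mul1r ?divr1 // invrN1 mulrN1 mulN1r opprK.
Qed.

Lemma norm_root_unity r (z : C) : (0 < r)%N -> z ^+ r = 1 -> `|z| = 1.
Proof.
move=> r0 zr; apply/eqP; rewrite -(@pexpr_eq1 _ _ r) //.
by rewrite -normrX zr normr1.
Qed.

Lemma mono_mx_Grpn r p t c : (0 < r)%N -> (forall j, c j ^+ r = 1) ->
  (\prod_j c j) ^+ (r %/ p) = 1 -> Grpn r p (mono_mx t c).
Proof.
move=> r0 cr cp; have c0 j : c j != 0.
  by apply: contra_eqN (cr j) => /eqP->; rewrite expr0n gtn_eqF // eq_sym oner_eq0.
have mE i j : (mono_mx t c i j != 0) = (i == t j).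
  by rewrite mxE; case: (i =P t j) => _; rewrite ?c0 ?eqxx.
split; last by rewrite det_ratio_mono_mx // => j; apply: (norm_root_unity r0).
split=> [i|j|i j]; rewrite ?mE.
- exists (t^-1%g i); split=> [|j]; rewrite mE; first by rewrite permKV.
  by move=> /eqP ->; rewrite permK.
- by exists (t j); split=> [|i]; rewrite mE // => /eqP.
- by rewrite mxE => ->.
Qed.

Lemma GrpnP r p A : (0 < r)%N -> Grpn r p A -> exists t c,
  [/\ A = mono_mx t c, forall j, c j ^+ r = 1 & (\prod_j c j) ^+ (r %/ p) = 1].
Proof.
move=> r0 [[rowA colA Ar] dA].
(* [h] sends a column to the row of its nonzero entry; uniqueness within rows makes it a
   permutation. *)
have /boolp.choice [h hP] : forall j, exists i, A i j != 0 /\ forall i', A i' j != 0 -> i = i'.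
  by move=> j; have [i [? ?]] := colA j; exists i.
have h_inj : injective h.
  move=> j j' hj; have [k [_ kP]] := rowA (h j).
  by rewrite -(kP j) ?(proj1 (hP j)) // -(kP j') // hj (proj1 (hP j')).
have AE : A = mono_mx (perm h_inj) (fun j => A (h j) j).
  apply/matrixP => i j; rewrite mxE permE; case: eqP => [->//|ij].
  by apply: contra_not_eq ij => /(proj2 (hP j)).
have cr j : A (h j) j ^+ r = 1 by apply: Ar; have [] := hP j.
exists (perm h_inj), (fun j => A (h j) j); split=> //.
move: dA; rewrite {1 2}AE det_ratio_mono_mx // => j.
exact: norm_root_unity (cr j).
Qed.

End Invariants.

(** * Action of monomial matrices on monomials *)

Section Action.
Variables (R : realType) (n : nat).
Local Notation C := R[i].
Implicit Types (m : 'X_{1..n + n}) (t : 'S_n) (c : 'I_n -> C) (f : {mpoly C[n + n]}).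

Lemma split_lshift (j : 'I_n) : split (lshift n j) = inl j.
Proof. exact: (unsplitK (inl j)). Qed.

Lemma split_rshift (j : 'I_n) : split (rshift n j) = inr j.
Proof. exact: (unsplitK (inr j)). Qed.

(* A monomial is encoded by its list of exponent pairs (x_j, y_j), so that its
   S_n-orbit is the class of this list under perm_eq. *)
Definition word m : n.-tuple (nat * nat) :=
  [tuple (m (lshift n j), m (rshift n j)) | j < n].

Definition mon (w : seq (nat * nat)) : 'X_{1..n + n} :=
  [multinom match split k with
            | inl j => (nth (0, 0)%N w j).1
            | inr j => (nth (0, 0)%N w j).2
            end | k < n + n].

Lemma wordK m : mon (word m) = m.
Proof.
apply/mnmP => k; rewrite mnmE -{2}(splitK k).
by case: (split k) => j; rewrite -tnth_nth tnth_mktuple.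
Qed.

Lemma monK (w : seq (nat * nat)) : size w = n -> word (mon w) = w :> seq _.
Proof.
move=> sw; apply: (@eq_from_nth _ (0, 0)%N); rewrite size_tuple // => k k_n.
rewrite -[k]/(val (Ordinal k_n)) -tnth_nth tnth_mktuple !mnmE.
by rewrite split_lshift split_rshift -surjective_pairing.
Qed.

Lemma xdeg_word m : xdeg m = sum1 (word m).
Proof.
rewrite /sum1 sumnE big_map big_tuple.
by apply: eq_bigr => i _; rewrite tnth_mktuple.
Qed.

Lemma ydeg_word m : ydeg m = sum2 (word m).
Proof.
rewrite /sum2 sumnE big_map big_tuple.
by apply: eq_bigr => i _; rewrite tnth_mktuple.
Qed.

Definition mperm t m : 'X_{1..n + n} :=
  [multinom match split k with
            | inl j => m (lshift n (t j))
            | inr j => m (rshift n (t j))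
            end | k < n + n].

Lemma word_mperm t m : word (mperm t m) = [tuple tnth (word m) (t j) | j < n].
Proof.
apply: eq_from_tnth => j.
by rewrite !tnth_mktuple !mnmE split_lshift split_rshift.
Qed.

Lemma perm_word m m' : perm_eq (word m) (word m') -> exists t, m = mperm t m'.
Proof.
move=> /tuple_permP[t wE]; exists t; rewrite -[LHS]wordK -[RHS]wordK.
by rewrite word_mperm wE.
Qed.

Lemma mpermK t : cancel (mperm t) (mperm t^-1%g).
Proof.
move=> m; apply/mnmP => k; rewrite mnmE -{2}(splitK k).
by case: (split k) => j; rewrite mnmE ?split_lshift ?split_rshift permKV.
Qed.

Lemma diag_subst_mono_mxL t c j :
  diag_subst (mono_mx t c) (lshift n j) = c j *: 'X_(lshift n (t j)).
Proof.
rewrite /diag_subst split_lshift (bigD1 (t j)) //= mxE eqxx big1 ?addr0 //.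
by move=> i /negPf it; rewrite mxE it scale0r.
Qed.

Lemma diag_subst_mono_mxR t c j :
  diag_subst (mono_mx t c) (rshift n j) = c j *: 'X_(rshift n (t j)).
Proof.
rewrite /diag_subst split_rshift (bigD1 (t j)) //= mxE eqxx big1 ?addr0 //.
by move=> i /negPf it; rewrite mxE it scale0r.
Qed.

(** The eigenvalue of the monomial [m] under the diagonal matrix with entries [c]; the exponents of
    x_j and y_j add up because both variables are scaled by [c j]. *)
Definition weight c m := \prod_j c j ^+ (m (lshift n j) + m (rshift n j)).

Lemma diag_act_mono_mxX t c m :
  diag_act (mono_mx t c) 'X_[m] = weight c m *: 'X_[mperm t^-1 m].
Proof.
rewrite /diag_act comp_mpolyX big_split_ord /=.
under eq_bigr => j _ do rewrite tnth_mktuple diag_subst_mono_mxL exprZn.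
under [X in _ * X]eq_bigr => j _ do rewrite tnth_mktuple diag_subst_mono_mxR exprZn.
rewrite !scaler_prod -scalerAl -scalerAr scalerA -big_split /=.
congr (_ *: _); first by apply: eq_bigr => j _; rewrite exprD.
rewrite mpolyXE_id big_split_ord /=; congr (_ * _).
  rewrite [RHS](reindex_inj (@perm_inj _ t)) /=.
  by apply: eq_bigr => j _; rewrite mnmE split_lshift permK.
rewrite [RHS](reindex_inj (@perm_inj _ t)) /=.
by apply: eq_bigr => j _; rewrite mnmE split_rshift permK.
Qed.

(** Monomials are permuted up to scalars, so only the preimage [mperm t m] of [m] contributes. *)
Lemma mcoeff_diag_act t c f m :
  (diag_act (mono_mx t c) f)@_m = weight c (mperm t m) * f@_(mperm t m).
Proof.
have mE m' : ('X_[mperm t^-1 m'] : {mpoly C[n + n]})@_m = (m' == mperm t m)%:R.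
  by rewrite mcoeffX -(inj_eq (can_inj (mpermK t))) -{1}(invgK t) mpermK.
rewrite /diag_act comp_mpolyEX raddf_sum /=.
under eq_bigr => m' _.
  rewrite mcoeffZ -/(diag_act _ _) diag_act_mono_mxX mcoeffZ mE; over.
have [mf|mf] := boolP (mperm t m \in msupp f).
  rewrite (bigD1_seq _ mf) ?msupp_uniq //= eqxx mulr1 mulrC big1 ?addr0 //.
  by move=> m' /negPf->; rewrite !mulr0.
rewrite (memN_msupp_eq0 mf) mulr0 big_seq big1 // => m' m'f.
by case: eqP => [mm'|_]; rewrite ?mulr0 // -mm' m'f in mf *.
Qed.

End Action.

Definition class_of r p l : pred (nat * nat) :=
  fun ij => (ij.1 + ij.2 == l * (r %/ p) %[mod r])%N.

(** The multiples of r/p by 0, ..., p-1 are distinct and below r. Thus a nonempty multiset is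
    counted for at most one [l]. *)
Lemma class_of_inj r p l l' ij : (0 < r)%N -> (p %| r)%N -> (l < p)%N -> (l' < p)%N ->
  class_of r p l ij -> class_of r p l' ij -> l = l'.
Proof.
move=> r0 pr lp lp' /eqP H /eqP; rewrite {}H => /eqP.
have q0 : (0 < r %/ p)%N by rewrite divn_gt0 ?(leq_ltn_trans _ lp) // dvdn_leq.
by rewrite -{2 4}(divnK pr) mulnC [(l' * _)%N]mulnC -!muln_modr ?modn_small // eqn_pmul2l //
  => /eqP.
Qed.

Lemma class_of_sum r p l w : all (class_of r p l) w ->
  (sum1 w + sum2 w = size w * (l * (r %/ p)) %[mod r])%N.
Proof.
rewrite /sum1 /sum2; elim: w => [//|x w IH] /= /andP[/eqP xl /IH wl].
by rewrite addnACA -modnDm xl wl modnDm mulSn.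
Qed.

(** * Bihomogeneous invariants and their basis of orbit sums *)

Section Bihom.
Variables (R : realType) (n r p s : nat).
Hypotheses (n_gt0 : (0 < n)%N) (r_gt0 : (0 < r)%N) (p_gt0 : (0 < p)%N).
Hypotheses (s_gt0 : (0 < s)%N) (p_dvd : (p %| r)%N).
Local Notation C := R[i].
Implicit Types (m : 'X_{1..n + n}) (t : 'S_n) (c : 'I_n -> C) (f : {mpoly C[n + n]}).
Implicit Types (w : seq (nat * nat)).

Definition admissible a b w := [&& size w == n, sum1 w == a, sum2 w == b,
  (s %| a)%N, (s %| b)%N & [exists l : 'I_p, all (class_of r p l) w]].

Lemma perm_admissible a b w w' : perm_eq w w' -> admissible a b w = admissible a b w'.
Proof.
move=> ww'; rewrite /admissible (perm_size ww') /sum1 /sum2.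
rewrite (perm_sumn (perm_map fst ww')) (perm_sumn (perm_map snd ww')).
by under eq_existsb => l do rewrite (perm_all _ ww').
Qed.

(** Only exponents modulo r matter, so the weight is the product of the [c j] raised to the power l
    r/p, hence a power of 1. *)
Lemma weight_eq1 c m (l : nat) : (forall j, c j ^+ r = 1) ->
  (\prod_j c j) ^+ (r %/ p) = 1 -> all (class_of r p l) (word m) -> weight c m = 1.
Proof.
move=> cr cp /all_tnthP ml; rewrite /weight.
under eq_bigr => j _.
  have := ml j; rewrite tnth_mktuple => /eqP /= mj.
  rewrite -(expr_mod _ (cr j)) mj (expr_mod _ (cr j)); over.
by rewrite prodrXl mulnC exprM cp expr1n.
Qed.

Lemma weight_class_of m : (forall c, (forall j, c j ^+ r = 1) ->
    (\prod_j c j) ^+ (r %/ p) = 1 -> weight c m = 1) ->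
  [exists l : 'I_p, all (class_of r p l) (word m)].
Proof.
move=> wt; pose e j := (m (lshift n j) + m (rshift n j))%N.
pose i0 := Ordinal n_gt0; pose z := zeta R r.
have z1 : z ^+ r = 1 by apply: zeta_exp1.
(* The diagonal matrix with entries z and z^-1 forces all e j to be congruent
   mod r; the one with the single nontrivial entry z^p forces r/p | e i0. *)
have eE j : e i0 = e j %[mod r].
  have [->//|ji] := eqVneq j i0.
  pose c k := if k == i0 then z else if k == j then z ^+ r.-1 else 1.
  have prodE (g : 'I_n -> nat) : \prod_k c k ^+ g k = z ^+ (g i0 + r.-1 * g j).
    rewrite (bigD1 i0) //= (bigD1 j) //= /c eqxx (negPf ji) eqxx big1 ?mulr1.
      by rewrite exprD exprM.
    by move=> k /andP[/negPf-> /negPf->]; rewrite expr1n.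
  have /wt : forall k, c k ^+ r = 1.
    by move=> k; rewrite /c; do 2?[case: eqP => _]; rewrite ?expr1n // exprAC z1 expr1n.
  rewrite -[X in X ^+ _]/(\prod_k c k ^+ (fun=> 1%N) k) prodE muln1 add1n prednK //.
  rewrite z1 expr1n => /(_ erefl); rewrite [weight c m](prodE e).
  move=> /(zeta_exp_eq1 r_gt0) /eqP ee.
  rewrite -[in RHS](add0n (e j)) -ee modnDml -addnA -mulSnr prednK //.
  by rewrite addnC mulnC modnMDl.
have /dvdnP[q e0] : (r %/ p %| e i0)%N.
  rewrite -(dvdn_pmul2l p_gt0) mulnC divnK //.
  pose c k := if k == i0 then z ^+ p else 1.
  have prodE (g : 'I_n -> nat) : \prod_k c k ^+ g k = z ^+ (p * g i0).
    rewrite (bigD1 i0) //= /c eqxx big1 ?mulr1 ?exprM //.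
    by move=> k /negPf->; rewrite expr1n.
  have /wt : forall k, c k ^+ r = 1.
    by move=> k; rewrite /c; case: ifP => _; rewrite ?expr1n // exprAC z1 expr1n.
  rewrite -[X in X ^+ _]/(\prod_k c k ^+ (fun=> 1%N) k) prodE muln1 -exprM.
  rewrite mulnC divnK // z1 => /(_ erefl); rewrite [weight c m](prodE e).
  exact: zeta_exp_eq1.
(* Reducing q modulo p brings the index below p and changes q r/p by a multiple of r. *)
apply/existsP; exists (Ordinal (ltn_pmod q p_gt0)); apply/all_tnthP => j.
rewrite tnth_mktuple /class_of /= -/(e j) -(eE j) e0 {1}(divn_eq q p) mulnDl.
by rewrite -mulnA [(p * _)%N]mulnC divnK // -modnDml modnMl.
Qed.

(** Diagonal matrices restrict the support, permutation matrices equate coefficients along orbits.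
    Both conditions together suffice because every group element is some [mono_mx t c]. *)
Lemma bihomP a b f : bihom (S_XY_inv r p s) a b f <->
  (forall m, m \in msupp f -> admissible a b (word m)) /\
  (forall m m', perm_eq (word m) (word m') -> f@_m = f@_m').
Proof.
split=> [[/(S_XY_invP _ _ _ s_gt0)[Sf inv_f] deg_f]|[adm_f perm_f]].
  have actE t c m : (forall j, c j ^+ r = 1) -> (\prod_j c j) ^+ (r %/ p) = 1 ->
      f@_m = weight c (mperm t m) * f@_(mperm t m).
    by move=> cr cp; rewrite -mcoeff_diag_act inv_f //; apply: mono_mx_Grpn.
  split=> [m mf|m m' /perm_word[t ->]]; last first.
    rewrite [RHS](actE t (fun=> 1)) ?big1_eq ?expr1n //.
    by rewrite /weight big1 ?mul1r // => j _; rewrite expr1n.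
  have [[xm ym] [sx sy]] := (deg_f m mf, (S_XYP s f).1 Sf m mf).
  rewrite /admissible size_tuple -xdeg_word -ydeg_word xm ym !eqxx -{1}xm -{1}ym sx sy /=.
  (* The coefficient at [m] is nonzero, so every diagonal matrix of the group has weight 1 at
     [m]. *)
  apply: weight_class_of => c cr cp; have := actE 1%g c m cr cp.
  have -> : mperm 1 m = m.
    by apply/mnmP => k; rewrite mnmE -{2}(splitK k); case: split => j; rewrite perm1.
  move=> /esym/eqP; rewrite -subr_eq0 -{2}[f@_m]mul1r -mulrBl mulf_eq0 subr_eq0.
  by rewrite mcoeff_eq0 mf orbF => /eqP.
split=> [|m /adm_f /and3P[_ /eqP xm /andP[/eqP ym _]]]; last first.
  by rewrite xdeg_word ydeg_word.
apply/(S_XY_invP _ _ _ s_gt0); split.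
  apply/S_XYP => m /adm_f; rewrite xdeg_word ydeg_word.
  by move=> /and5P[_ /eqP-> /eqP-> -> /andP[-> _]].
move=> A /(GrpnP r_gt0)[t [c [-> cr cp]]]; apply/mpolyP => m.
rewrite mcoeff_diag_act (perm_f (mperm t m) m); last first.
  by rewrite word_mperm; apply/tuple_permP; exists t.
have [mf|mf] := boolP (m \in msupp f); last by rewrite (memN_msupp_eq0 mf) mulr0.
have : admissible a b (word (mperm t m)).
  rewrite (perm_admissible _ _ (w' := word m)) ?adm_f //.
  by rewrite word_mperm; apply/tuple_permP; exists t.
move=> /and5P[_ _ _ _ /andP[_ /existsP[l ml]]].
by rewrite (weight_eq1 cr cp ml) mul1r.
Qed.

(** [permutations] lists distinct rearrangements, so each monomial of the orbit has coefficient 1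
    even when pairs repeat. *)
Definition orbit_sum w : {mpoly C[n + n]} := \sum_(v <- permutations w) 'X_[mon n v].

Lemma mcoeff_orbit_sum w m : size w = n ->
  (orbit_sum w)@_m = (perm_eq (word m) w)%:R.
Proof.
move=> sw; rewrite raddf_sum /= -mem_permutations.
rewrite (eq_big_seq (fun v : seq (nat * nat) => (v == word m)%:R)); last first.
  move=> v; rewrite mem_permutations => /perm_size; rewrite sw => sv.
  rewrite mcoeffX; congr (_ %:R); congr nat_of_bool.
  by apply/eqP/eqP => [<-|->]; rewrite ?wordK ?monK.
rewrite -natr_sum -(count_uniq_mem _ (permutations_uniq w)) -sum1_count.
by rewrite [in RHS]big_mkcond; congr (_ %:R); apply: eq_bigr => v _ /=; case: eqP.
Qed.

Lemma sum_perm_eq (W : seq (seq (nat * nat))) w (F : 'I_(size W) -> C) (i : 'I_(size W)) :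
  count (perm_eq w) W = 1%N -> perm_eq w (nth [::] W i) ->
  \sum_j F j * (perm_eq w (nth [::] W j))%:R = F i.
Proof.
rewrite -sum1_count big_mkcond (big_nth [::]) big_mkord (bigD1 i) //= => cW wi.
move: cW; rewrite wi => -[/eqP]; rewrite sum_nat_eq0 => /forallP W0.
rewrite (bigD1 i) //= wi mulr1 big1 ?addr0 // => j ji.
by have := W0 j; rewrite ji /=; case: ifP => // _; rewrite mulr0.
Qed.

(** Distinct entries of [W] have disjoint orbits, so the coefficient at the monomial of the i-th
    word isolates the i-th scalar. This gives freeness, and it dictates the scalars that express an
    invariant [f]. *)
Lemma has_dim_bihom a b (W : seq (seq (nat * nat))) :
  (forall w, w \in W -> admissible a b w) ->
  (forall w, admissible a b w -> count (perm_eq w) W = 1%N) ->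
  has_dim (bihom (S_XY_inv (R := R) (n := n) r p s) a b) (size W).
Proof.
move=> admW cW; pose w_ (i : 'I_(size W)) := nth [::] W i.
have adm_w i : admissible a b (w_ i) by apply: admW; apply: mem_nth.
have size_w i : size (w_ i) = n by case/andP: (adm_w i) => /eqP.
have coefE (c : 'I_(size W) -> C) m : (\sum_i c i *: orbit_sum (w_ i))@_m =
    \sum_i c i * (perm_eq (word m) (w_ i))%:R.
  rewrite raddf_sum; apply: eq_bigr => i _.
  by rewrite /= mcoeffZ mcoeff_orbit_sum.
exists (fun i => orbit_sum (w_ i)); split=> [i|c c0 i|f /bihomP[adm_f perm_f]].
- apply/bihomP; split=> [m|m m' mm']; last first.
    by rewrite !mcoeff_orbit_sum // (permPl mm').
  rewrite mcoeff_msupp mcoeff_orbit_sum // pnatr_eq0 eqb0 negbK => mi.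
  by rewrite (perm_admissible _ _ mi).
- have := congr1 (mcoeff (mon n (w_ i))) c0; rewrite coefE mcoeff0 monK //.
  by rewrite (sum_perm_eq _ (cW _ (adm_w i)) (perm_refl _)).
- exists (fun i => f@_(mon n (w_ i))); apply/mpolyP => m; rewrite coefE.
  have [adm_m|adm_m] := boolP (admissible a b (word m)).
    have /(has_nthP [::])[i iW mi] : has (perm_eq (word m)) W by rewrite has_count cW.
    rewrite (sum_perm_eq _ (i := Ordinal iW) (cW _ adm_m) mi).
    by apply: perm_f; rewrite monK.
  rewrite (memN_msupp_eq0 (contra (adm_f m) adm_m)) big1 // => i _.
  have [mi|_] := boolP (perm_eq (word m) (w_ i)); last by rewrite mulr0.
  by rewrite (perm_admissible _ _ mi) adm_w in adm_m.
Qed.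

End Bihom.

(** * Orbit representatives and comparison of the two counts *)

Definition class_msets r p n a b l :=
  [seq w <- msets [seq ij <- box a b | class_of r p l ij] n |
    (sum1 w == a) && (sum2 w == b)].

Definition admissible_reps r p n a b : seq (seq (nat * nat)) :=
  flatten [seq class_msets r p n a b (val l) | l <- enum 'I_p].

Lemma size_admissible_reps r p n a b :
  size (admissible_reps r p n a b) = (\sum_(l < p) size (class_msets r p n a b l))%N.
Proof. by rewrite size_flatten sumnE /shape 2!big_map big_enum. Qed.

(** After multiplication by p the claim is that sp divides n r. With g = gcd(sp, r), n is a multiple
    of sp/g, and (sp/g) r = sp (r/g). *)
Lemma dvdn_mul_quotient r p s n : (0 < r)%N -> (0 < p)%N -> (p %| r)%N ->
  (s * p %/ gcdn (s * p) r %| n)%N -> (s %| n * (r %/ p))%N.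
Proof.
move=> r0 p0 pr /dvdnP[k ->]; rewrite -(dvdn_pmul2r p0) -[X in (_ %| X)%N]mulnA divnK //.
by rewrite -mulnA dvdn_mull // [X in (_ %| X)%N]mulnC -muln_divCA_gcd dvdn_mulr.
Qed.

Lemma class_msetsP r p s n a b (l : nat) w :
  (0 < r)%N -> (0 < p)%N -> (s %| r)%N -> (p %| r)%N -> (l < p)%N ->
  (s * p %/ gcdn (s * p) r %| n)%N -> (s %| a)%N ->
  w \in class_msets r p n a b l -> admissible n r p s a b w.
Proof.
move=> r0 p0 sr pr lp dn sa; rewrite mem_filter => /andP[/andP[/eqP wa /eqP wb]].
move=> /msets_sub[sw wl]; have wcl : all (class_of r p l) w.
  by apply/allP => ij /wl; rewrite mem_filter => /andP[].
rewrite /admissible sw wa wb sa !eqxx /=; apply/andP; split; last first.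
  by apply/existsP; exists (Ordinal lp).
(* The congruence of a + b with n l r/p modulo r also holds modulo s, so s | a gives s | b. *)
rewrite -(dvdn_addr _ sa) -wa -wb; have /(congr1 (modn^~ s)) := class_of_sum wcl.
rewrite !modn_dvdm // sw mulnCA => wE; rewrite /dvdn wE.
by apply/dvdn_mull/dvdn_mul_quotient.
Qed.

Lemma count_class_msets r p s n a b (l l' : 'I_p) w : (0 < n)%N -> (0 < r)%N -> (p %| r)%N ->
  admissible n r p s a b w -> all (class_of r p l) w ->
  count (perm_eq w) (class_msets r p n a b l') = (l' == l).
Proof.
move=> n0 r0 pr /and5P[/eqP sw /eqP wa /eqP wb _ _] wl.
rewrite count_filter; case: eqP => [->|l'l]; last first.
  rewrite (@eq_in_count _ _ pred0) ?count_pred0 // => v /msets_sub[_ vl] /=.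
  apply/negP => /andP[/perm_mem wv _]; apply: l'l; apply: val_inj => /=.
  (* The empty word lies in all p classes at once, which is why degree 0 in u is excluded. *)
  case: w sw wl wv {wa wb} => [n0'|ij w _ /= /andP[ijl _] wv]; first by rewrite -n0' in n0.
  apply: (@class_of_inj r p l' l ij) => //.
  have /vl : ij \in v by rewrite -wv mem_head.
  by rewrite mem_filter => /andP[].
rewrite (@eq_count _ _ (perm_eq w)).
  rewrite -sw; apply: count_msets; first by rewrite filter_uniq ?box_uniq.
  (* Each coordinate of a pair in [w] is at most the corresponding sum, so [w] stays in the box. *)
  move=> ij ijw; rewrite mem_filter (allP wl) //= mem_box -wa -wb /sum1 /sum2 !sumnE.
  by rewrite !big_map !(perm_big _ (perm_to_rem ijw)) !big_cons !leq_addr.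
move=> v /=; have [wv|//] := boolP (perm_eq w v).
by rewrite -wa -wb /sum1 /sum2 !(perm_sumn (perm_map _ wv)) !eqxx.
Qed.

Lemma count_admissible_reps r p s n a b w : (0 < n)%N -> (0 < r)%N -> (p %| r)%N ->
  admissible n r p s a b w -> count (perm_eq w) (admissible_reps r p n a b) = 1%N.
Proof.
move=> n0 r0 pr adm_w; have /and5P[_ _ _ _ /andP[_ /existsP[l wl]]] := adm_w.
rewrite count_flatten sumnE 2!big_map big_enum /=.
under eq_bigr => l' _ do rewrite (count_class_msets l' n0 r0 pr adm_w wl).
by rewrite (bigD1 l) //= eqxx big1 ?addn0 // => l' /negPf->.
Qed.

Theorem corollary6p5 (R : realType) (r p s : nat)
    (r_gt0 : (0 < r)%N) (p_gt0 : (0 < p)%N) (s_gt0 : (0 < s)%N)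
    (s_dvd : (s %| r)%N) (p_dvd : (p %| r)%N) :
  let d := ((s * p) %/ gcdn (s * p) r)%N in
  let lhs : fps3 := FPS (fun n : nat =>
    if (0 < n)%N && (d %| n)%N then Hilb (@S_XY_inv R n r p s) else 0) in
  let rhs : fps3 := keep_multiples d s
    (\sum_(l < p)
       fps_prod (fun ij : nat * nat =>
                   (ij.1 + ij.2 == l * (r %/ p) %[mod r])%N)
                (fun ij => 1 / (1 - ser_u * ser_q1 ^+ ij.1 * ser_q2 ^+ ij.2))) in
  forall n : nat, (0 < n)%N -> lhs n = rhs n.
Proof.
move=> d lhs rhs n n_gt0; apply: fpsP => a; apply: fpsP => b.
rewrite /lhs /rhs /= n_gt0 /=; have [dn|//] := boolP (d %| n)%N.
have [sa|sa] := boolP (s %| a)%N; rewrite /=; last first.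
  (* If s does not divide a, no word is admissible: the empty family is a basis and both sides
     vanish. *)
  rewrite (@dim_ofE _ _ _ 0) // -[0%N]/(size (@nil (seq (nat * nat)))).
  by apply: has_dim_bihom => // w /and5P[_ _ _ sa' _]; rewrite sa' in sa.
rewrite (@dim_ofE _ _ _ (size (admissible_reps r p n a b))).
  rewrite size_admissible_reps !fps_coef_sum -natz natr_sum.
  apply: eq_bigr => l _; rewrite -/geom coef_fps_prod_geom.
  by rewrite /class_msets size_filter.
apply: has_dim_bihom => // w; last exact: count_admissible_reps.
move=> /flattenP[ws /mapP[l _ ->]].
exact: class_msetsP (ltn_ord l) dn sa.
Qed.
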